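(* Let $\Phi$ be Euler's totient function. For every integer $c\ge 2$ and every generated scale $A\subset\mathbb{Z}_c$ with at least two elements, the number of generators of $A$ is a totient number, i.e. it equals $\Phi(n)$ for some positive integer $n$. Conversely, for every positive integer $n$ there exist a positive integer $c$ and a generated scale $A\subset\mathbb{Z}_c$ with at least two elements having exactly $\Phi(n)$ generators.
   Context: $\mathbb{Z}_c=\mathbb{Z}/c\mathbb{Z}$ is the cyclic group with $c$ elements. A scale is a subset of $\mathbb{Z}_c$. A scale $A$ with $d$ elements is generated by $f\in\mathbb{Z}_c$ (and $f$ is a generator of $A$) if $A=\{a,a+f,a+2f,\dots,a+(d-1)f\}$ for some $a\in A$. A generated scale is one that has at least one generator. The number of generators of $A$ is the number of distinct $f\in\mathbb{Z}_c$ that generate $A$. *)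

(* Defs.v *)
From mathcomp Require Import all_boot all_algebra.

Set Implicit Arguments.
Unset Strict Implicit.
Unset Printing Implicit Defensive.

Import GRing.Theory.

Local Open Scope ring_scope.

(* A scale is a set A : {set 'Z_c}.  The notions below only use the additive
   group structure, so they are given over any finite abelian group V.  Beware
   that 'Z_c is the integers modulo c only for c > 1 ('Z_1 is convertible
   to 'Z_2), so they are meant to be used on 'Z_c together with 1 < c; the
   trivial group Z/1Z has no scale with two elements. *)

(* f generates A when A = {a, a + f, ..., a + (d - 1) f} for some a in A,
   where d = #|A|. *)
Definition generates (V : finZmodType) (A : {set V}) (f : V) : bool :=
  [exists a in A, A == [set a + f *+ k | k : 'I_#|A|]].

Definition generators (V : finZmodType) (A : {set V}) : {set V} :=
  [set f | generates A f].

Definition generated (V : finZmodType) (A : {set V}) : Prop :=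
  exists f : V, generates A f.

(* Main.v *)
From mathcomp Require Import all_boot all_algebra fingroup cyclic zify.
Require Import Defs.

(** Let [f] generate [A], put [d = #|A|] and let [m >= d] be the order of [f].
    As soon as [d >= 2], the step of a progression is a difference of two of its
    elements, so all generators of [A] span the same cyclic group [<[f]>], and
    [A] lies in one coset of it.  How much of the coset is left out decides the
    count.

    If [d = m], then [A] is the whole coset and every one of the [totient m]
    elements spanning [<[f]>] runs through it ([generators_coset]).  If
    [d = m - 1], then [A] is the coset without one point, and every such element
    still runs through it, starting just after the missing point
    ([generators_punctured_coset]).  If [d <= m - 2], a step [f *+ k] with
    [2 <= k <= m - 2] would leave [A] from two different points of [A], whereas
    a progression is left by its own step from its last point only; so the
    generators are [f] and [- f], two in number, and [2 = totient 3]
    ([generators_short]).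

    Conversely ['Z_n] itself, for [n >= 2], is a scale with [totient n]
    generators, and [totient 1 = totient 2]. *)

Set Implicit Arguments.
Unset Strict Implicit.
Unset Printing Implicit Defensive.

Import GRing.Theory FinRing.Theory.

Section Progressions.

Local Open Scope ring_scope.

Variable V : finZmodType.
Implicit Types (A : {set V}) (a b f g x : V) (d i j k : nat).

Definition progression a f d : {set V} := [set a + f *+ k | k : 'I_d].

Lemma progressionP a f d x :
  reflect (exists2 k, (k < d)%N & x = a + f *+ k) (x \in progression a f d).
Proof.
apply: (iffP imsetP) => [[k _ ->]|[k ltkd ->]]; first by exists k.
by exists (Ordinal ltkd).
Qed.

Lemma generatesP A f : (0 < #|A|)%N ->
  reflect (exists a, A = progression a f #|A|) (generates A f).
Proof.
move=> A_gt0; apply: (iffP existsP) => [[a /andP[_ /eqP eqA]]|[a eqA]].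
  by exists a.
exists a; rewrite -[X in _ == X]/(progression a f #|A|) -eqA eqxx andbT eqA.
by apply/progressionP; exists 0%N; rewrite ?addr0.
Qed.

Lemma mulrn_mod_order f i j : (f *+ i == f *+ j) = (i == j %[mod #[f]%g])%N.
Proof. by rewrite -!zmodXgE eq_expg_mod_order. Qed.

Lemma mulrn_order f : f *+ #[f]%g = 0.
Proof. by rewrite -zmodXgE expg_order. Qed.

Lemma mem_cycle_mulrn f k : f *+ k \in <[f]>%g.
Proof. by rewrite -zmodXgE mem_cycle. Qed.

Lemma cycle_mulrnP f x :
  x \in <[f]>%g -> exists2 k, (k < #[f]%g)%N & x = f *+ k.
Proof. by case/cyclePmin=> k ltk ->; exists k; rewrite // zmodXgE. Qed.

Lemma card_progression_le a f d : (#|progression a f d| <= d)%N.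
Proof. by rewrite (leq_trans (leq_imset_card _ _)) // card_ord. Qed.

Lemma progression_sub_cycle a f d x y :
  x \in progression a f d -> y \in progression a f d -> x - y \in <[f]>%g.
Proof.
case/progressionP=> i _ -> /progressionP[j _ ->].
rewrite opprD addrACA subrr add0r -zmodVgE -zmodMgE.
by rewrite groupM ?groupV ?mem_cycle_mulrn.
Qed.

Lemma mem_coset_progression a f x :
  (x \in progression a f #[f]%g) = (x - a \in <[f]>%g).
Proof.
apply/progressionP/idP => [[k _ ->]|/cycle_mulrnP[k ltk eqk]].
  by rewrite addrC addKr mem_cycle_mulrn.
by exists k; rewrite // -eqk addrC subrK.
Qed.

(** Leaving out the end of a full turn around the coset. *)
Lemma mem_punctured_progression a f x :
  (x \in progression (a + f) f #[f]%g.-1) = (x - a \in <[f]>%g) && (x != a).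
Proof.
have m_gt0 := order_gt0 f.
have shift k : a + f + f *+ k = a + f *+ k.+1 by rewrite mulrS addrA.
apply/progressionP/andP => [[k ltk ->]|[/cycle_mulrnP[[|k] ltk eqk] neqx]].
- rewrite shift addrC addKr mem_cycle_mulrn; split=> //.
  apply/eqP => /(canRL (addKr a)); rewrite addNr => /eqP.
  by rewrite -[0]/(f *+ 0) mulrn_mod_order mod0n modn_small //; lia.
- by rewrite -subr_eq0 eqk eqxx in neqx.
exists k; first lia.
by rewrite shift -eqk addrC subrK.
Qed.

(** Until the coset is exhausted, no point of it is met twice. *)
Lemma mem_progression_lt a f d j : (d <= #[f]%g)%N -> (j < #[f]%g)%N ->
  (a + f *+ j \in progression a f d) = (j < d)%N.
Proof.
move=> led ltj; apply/progressionP/idP => [[k ltk /addrI/eqP]|ltjd].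
  by rewrite mulrn_mod_order !modn_small ?(leq_trans ltk) // => /eqP->.
by exists j.
Qed.

Lemma card_generated_le A f : (0 < #|A|)%N -> generates A f ->
  (#|A| <= #[f]%g)%N.
Proof.
move=> A_gt0 /generatesP[//|a eqA].
apply: leq_trans (card_progression_le a f #[f]%g).
apply/subset_leq_card/subsetP => x; rewrite eqA => /progressionP[k _ ->].
by rewrite mem_coset_progression addrC addKr mem_cycle_mulrn.
Qed.

(** A step is the difference of the first two points of its progression. *)
Lemma generates_mem_cycle A f g : (1 < #|A|)%N ->
  generates A f -> generates A g -> g \in <[f]>%g.
Proof.
move=> A_gt1 /generatesP[|a eqA]; first lia.
case/generatesP=> [|b eqA']; first lia.
have inA k : (k < #|A|)%N -> b + g *+ k \in progression a f #|A|.
  by move=> ltk; rewrite -eqA eqA'; apply/progressionP; exists k.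
have := progression_sub_cycle (inA 1%N A_gt1) (inA 0%N (ltnW A_gt1)).
by rewrite addr0 addrC addKr.
Qed.

Lemma generates_cycle A f g : (1 < #|A|)%N ->
  generates A f -> generates A g -> generator <[f]>%g g.
Proof.
move=> A_gt1 genf geng; rewrite /generator eqEsubset !cycle_subG.
by rewrite (generates_mem_cycle A_gt1 geng) ?(generates_mem_cycle A_gt1 genf).
Qed.

(** Membership in a whole coset of [<[f]>] does not depend on which element
    spans [<[f]>]. *)
Lemma generators_coset A f : (1 < #|A|)%N -> generates A f ->
  #|A| = #[f]%g -> generators A = [set g | generator <[f]>%g g].
Proof.
move=> A_gt1 genf cardA; apply/setP => g; rewrite !inE.
apply/idP/idP => [|/eqP eqfg]; first exact: generates_cycle.
have A_gt0 := ltnW A_gt1; have [a eqA] := generatesP _ A_gt0 genf.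
apply/generatesP=> //; exists a; apply/setP=> x.
have -> : #|A| = #[g]%g by rewrite cardA /order eqfg.
by rewrite eqA cardA !mem_coset_progression eqfg.
Qed.

(** The missing point is [a - f] when the progression starts at [a]; with step
    [g] the progression starts at [a - f + g]. *)
Lemma generators_punctured_coset A f : (1 < #|A|)%N -> generates A f ->
  #|A| = #[f]%g.-1 -> generators A = [set g | generator <[f]>%g g].
Proof.
move=> A_gt1 genf cardA; apply/setP => g; rewrite !inE.
apply/idP/idP => [|/eqP eqfg]; first exact: generates_cycle.
have A_gt0 := ltnW A_gt1; have [a eqA] := generatesP _ A_gt0 genf.
apply/generatesP=> //; exists (a - f + g); apply/setP=> x.
have -> : #|A| = #[g]%g.-1 by rewrite cardA /order eqfg.
rewrite eqA cardA -{1}[a](subrK f).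
by rewrite !mem_punctured_progression eqfg.
Qed.

Lemma generates_opp A f : (0 < #|A|)%N -> generates A f -> generates A (- f).
Proof.
move=> A_gt0 /(generatesP _ A_gt0)[a eqA].
apply/generatesP=> //; exists (a + f *+ #|A|.-1).
set d := #|A| in A_gt0 eqA *; rewrite {1}eqA; apply/setP=> x.
have rev k : (k < d)%N -> f *+ (d.-1 - k) = f *+ d.-1 + (- f) *+ k.
  by move=> ltk; rewrite mulrnBr ?mulNrn //; lia.
apply/progressionP/progressionP=> -[k ltk ->]; exists (d.-1 - k)%N; try lia.
  by rewrite -addrA -rev; [congr (_ + _ *+ _)|]; lia.
by rewrite rev // addrA.
Qed.

(** Every point of a progression but the last is followed by another one. *)
Lemma progression_exit_unique b g d x y :
  x \in progression b g d -> x + g \notin progression b g d ->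
  y \in progression b g d -> y + g \notin progression b g d -> x = y.
Proof.
have last z : z \in progression b g d -> z + g \notin progression b g d ->
    z = b + g *+ d.-1.
  case/progressionP=> k ltk -> /progressionP out; congr (_ + _ *+ _).
  have [ltSk|] := ltnP k.+1 d; last lia.
  by case: out; exists k.+1; rewrite // mulrSr addrA.
by move=> xP /last-> // yP /last->.
Qed.

(** If [2 <= k <= #[f] - 2], the points of indices [d - k] and [d - k + 1]
    (truncated subtraction) are both sent out of the progression by adding
    [f *+ k], to indices in the gap between [d] and [#[f] - 1]. *)
Lemma generates_short_step A f k : (1 < #|A|)%N -> (#|A| + 2 <= #[f]%g)%N ->
  generates A f -> (k < #[f]%g)%N -> generates A (f *+ k) ->
  [\/ k = 0%N, k = 1%N | k = #[f]%g.-1].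
Proof.
move=> A_gt1 le_dm genf ltk geng; have A_gt0 := ltnW A_gt1.
have [/andP[k_ge2 k_le]|] := boolP ((2 <= k) && (k + 2 <= #[f]%g))%N; last first.
  case: k ltk {geng} => [|[|k]] ltk kP; [by constructor 1|by constructor 2|].
  by constructor 3; lia.
have [a eqA] := generatesP _ A_gt0 genf; have [b eqA'] := generatesP _ A_gt0 geng.
set d := #|A| in A_gt1 A_gt0 le_dm eqA eqA' *.
have led : (d <= #[f]%g)%N by lia.
pose i := (d - k)%N.
have inA j : (i <= j <= i.+1)%N -> a + f *+ j \in progression b (f *+ k) d.
  by move=> jP; rewrite -eqA' eqA mem_progression_lt //; lia.
have outA j : (i <= j <= i.+1)%N ->
    a + f *+ j + f *+ k \notin progression b (f *+ k) d.
  move=> jP; rewrite -eqA' eqA -addrA -mulrnDr mem_progression_lt //; lia.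
have iP : (i <= i <= i.+1)%N by rewrite leqnn leqnSn.
have SiP : (i <= i.+1 <= i.+1)%N by rewrite leqnn leqnSn.
have /addrI/eqP := progression_exit_unique
  (inA _ iP) (outA _ iP) (inA _ SiP) (outA _ SiP).
by rewrite mulrn_mod_order !modn_small; lia.
Qed.

Lemma generators_short A f : (1 < #|A|)%N -> generates A f ->
  (#|A| + 2 <= #[f]%g)%N -> generators A = [set f; - f].
Proof.
move=> A_gt1 genf le_dm; have A_gt0 := ltnW A_gt1.
apply/setP=> g; rewrite !inE; apply/idP/orP=> [geng|[]/eqP->//]; last first.
  exact: generates_opp.
have [k ltk eqg] := cycle_mulrnP (generates_mem_cycle A_gt1 genf geng).
rewrite eqg in geng *.
case: (generates_short_step A_gt1 le_dm genf ltk geng) => eqk.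
(* A step 0, of order 1, cannot reach two points. *)
- by have := card_generated_le A_gt0 geng; rewrite eqk mulr0n order1; lia.
- by left; rewrite eqk.
right; rewrite eqk -addr_eq0 -mulrSr prednK ?order_gt0 //.
by rewrite mulrn_order.
Qed.

Lemma card_generators_totient A : (1 < #|A|)%N -> generated A ->
  exists n, (0 < n)%N /\ #|generators A| = totient n.
Proof.
move=> A_gt1 [f genf]; have le_dm := card_generated_le (ltnW A_gt1) genf.
have [short|long] := leqP (#|A| + 2) #[f]%g.
  exists 3; split=> //; rewrite (generators_short A_gt1 genf short) cards2.
  rewrite -addr_eq0 -mulr2n -[0]/(f *+ 0) mulrn_mod_order mod0n modn_small //.
  lia.
exists #[f]%g; rewrite order_gt0 totient_gen; split=> //; congr #|pred_of_set _|.
have [cardA|neq] := eqVneq #|A| #[f]%g; first exact: generators_coset.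
by apply: generators_punctured_coset=> //; lia.
Qed.

End Progressions.

Lemma generates_Zp n : 1 < n -> generates [set: 'Z_n] 1%R.
Proof.
move=> n_gt1.
have cardZ : #|[set: 'Z_n]| = n by rewrite cardsT card_ord Zp_cast.
apply/generatesP; rewrite cardZ; first exact: ltnW.
exists 0%R; apply/esym/setP=> x; rewrite inE; apply/progressionP.
exists x; first by rewrite -[X in _ < X](Zp_cast n_gt1).
by rewrite add0r natr_Zp.
Qed.

Lemma card_generators_Zp n : 1 < n ->
  #|generators [set: 'Z_n]| = totient n.
Proof.
move=> n_gt1.
have cardZ : #|[set: 'Z_n]| = n by rewrite cardsT card_ord Zp_cast.
have ord1 : #[1%R : 'Z_n]%g = n by rewrite order_Zp1 Zp_cast.
rewrite (@generators_coset _ _ 1%R) ?cardZ //; last exact: generates_Zp.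
by rewrite -totient_gen ord1.
Qed.

Theorem mainTheorem1 :
  (forall (c : nat) (A : {set 'Z_c}),
     1 < c -> generated A -> 2 <= #|A| ->
     exists n : nat, 0 < n /\ #|generators A| = totient n)
  /\
  (forall n : nat, 0 < n ->
     exists (c : nat) (A : {set 'Z_c}),
       [/\ 1 < c, generated A, 2 <= #|A| & #|generators A| = totient n]).
Proof.
split=> [c A _ genA A_gt1|n n_gt0]; first exact: card_generators_totient.
have full c : 1 < c -> totient c = totient n ->
    exists (c : nat) (A : {set 'Z_c}),
      [/\ 1 < c, generated A, 2 <= #|A| & #|generators A| = totient n].
  move=> c_gt1 <-; exists c, [set: 'Z_c]; split=> //.
  - by exists 1%R; apply: generates_Zp.
  - by rewrite cardsT card_ord Zp_cast.
  exact: card_generators_Zp.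
case: n n_gt0 full => [|[|n]] // _ full; first exact: (full 2).
exact: (full n.+2).
Qed.
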